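(* For every integer $n\ge 5$, all eigenvalues (in $\mathbb{C}$) of the discrete Laplacian $L\in\mathbb{R}^{n\times n}$ constructed by the fourth-order one-sided finite-difference scheme are real and positive.
   Context: Let $n\ge 5$ and $h=1/(n+1)$. The discrete Laplacian of the fourth-order one-sided scheme is the matrix $L=\frac{1}{12h^2}M\in\mathbb{R}^{n\times n}$, where $M$ has the following entries. - First row: $M_{1,1}=20$, $M_{1,2}=-6$, $M_{1,3}=-4$, $M_{1,4}=1$, and $M_{1,j}=0$ for $j\ge 5$. - Rows $2\le i\le n-1$: $M_{i,j}=30$ if $j=i$, $M_{i,j}=-16$ if $|i-j|=1$, $M_{i,j}=1$ if $|i-j|=2$, and $M_{i,j}=0$ otherwise (for $1\le j\le n$). - Last row: $M_{n,n}=20$, $M_{n,n-1}=-6$, $M_{n,n-2}=-4$, $M_{n,n-3}=1$, and $M_{n,j}=0$ for $j\le n-4$. (This is the fourth-order central difference discretization of $-\mathrm{d}^2/\mathrm{d}x^2$ on $(0,1)$ with homogeneous Dirichlet boundary conditions on the uniform grid $x_i=ih$, with a one-sided third-order formula used at the two near-boundary points.) *)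

(* Defs.v *)
From HB Require Import structures.
From mathcomp Require Import all_boot all_order all_algebra.
From mathcomp Require Import complex reals.

Set Implicit Arguments.
Unset Strict Implicit.
Unset Printing Implicit Defensive.

Import Order.TTheory GRing.Theory Num.Theory.
Local Open Scope ring_scope.

(* Rows and columns are numbered from 0: the grid point x_i of the scheme,
   1 <= i <= n, has index i - 1 in 'I_n. *)

(* [k] is the offset from the diagonal, pointing into the domain. *)
Definition boundary_coef (R : pzRingType) (k : nat) : R :=
  match k with
  | 0 => 20%:R
  | 1 => - 6%:R
  | 2 => - 4%:R
  | 3 => 1
  | _ => 0
  end.

Definition interior_coef (R : pzRingType) (d : nat) : R :=
  match d with
  | 0 => 30%:R
  | 1 => - 16%:R
  | 2 => 1
  | _ => 0
  end.

Definition stencil_mx (R : pzRingType) (n : nat) : 'M[R]_n :=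
  \matrix_(i < n, j < n)
    if i == 0 :> nat then boundary_coef R j
    else if i == n.-1 :> nat then boundary_coef R (n.-1 - j)
    else interior_coef R `|i%:Z - j%:Z|%N.

Definition mesh_size (R : fieldType) (n : nat) : R := 1 / n.+1%:R.

Definition discrete_laplacian (R : fieldType) (n : nat) : 'M[R]_n :=
  (1 / (12%:R * mesh_size R n ^+ 2)) *: stencil_mx R n.

(* Main.v *)
Require Import Defs.
From HB Require Import structures.
From mathcomp Require Import all_boot all_order all_algebra.
From mathcomp Require Import complex reals ring zify.

Set Implicit Arguments.
Unset Strict Implicit.
Unset Printing Implicit Defensive.

Import Order.TTheory GRing.Theory Num.Theory.
Local Open Scope ring_scope.

(** The stencil matrix [M] is a perturbation of the polynomial [12 T + T^2] in
    the second-difference matrix [T = tridiag(-1, 2, -1)], concentrated in the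
    first and last rows.  The one-sided rows say that a fifth difference
    vanishes at each end, and this makes the perturbation factor through [T]:
      [M = 12 T + T^2 + F T^2 (1 - T)],
    where [F] is the orthogonal projection on the first and last coordinates
    ([stencil_mxE]).  Hence
      [13 - M = (13 + T - F T^2) (1 - T)],
    and conjugation by [T] turns the first factor into the symmetric matrix
    [K = 13 + T - T F T]:
      [T (13 - M) T^-1 = K (1 - T)].
    Everything else uses only [0 < T <= 4] and that [F] is an orthogonal
    projection.

    First, [K >= 13 + T - T^2 >= 1] because the spectrum of [T] lies in
    [[0, 4]] ([end_corrected_form_ge]).  So [K (1 - T)], a product of two
    symmetric matrices one of which is positive definite, has real spectrum,
    and so does [M].  Secondly, write [A = 13 + T]; then [K <= A] gives
    [K^-1 >= A^-1], whence
      [13 K^-1 - (1 - T) >= A^-1 (13 - A (1 - T)) = A^-1 (12 T + T^2) > 0].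
    Evaluated at [y = x K], with [x] a row vector, this says
      [13 <x, x K> - <y (1 - T), y> > 0]   ([spectral_gap]),
    and if [x T] is a left eigenvector of [M] for [z], the left-hand side is
    [z <x, x K>].  As [<x, x K> > 0], this one inequality yields both
    conclusions at once: [z] is real and positive. *)

(** * Hermitian forms given by matrices *)

Local Open Scope sesquilinear_scope.
Local Notation "''[' u , v ]" := (dotmx u v) : ring_scope.
Local Notation "''[' u ]" := (dotmx u u) : ring_scope.

Section Forms.
Variable C : numClosedFieldType.

Lemma dotmxMl m n (A : 'M[C]_(m, n)) (u : 'rV_m) (v : 'rV_n) :
  '[u *m A, v] = '[u, v *m A ^t*].
Proof. by rewrite !dotmxE trmx_mul map_mxM trmxCK mulmxA. Qed.

Lemma dotmxDl n (u v w : 'rV[C]_n) : '[u + v, w] = '[u, w] + '[v, w].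
Proof. exact: linearDl. Qed.
Lemma dotmxDr n (u v w : 'rV[C]_n) : '[w, u + v] = '[w, u] + '[w, v].
Proof. exact: linearDr. Qed.
Lemma dotmxNl n (u w : 'rV[C]_n) : '[- u, w] = - '[u, w].
Proof. exact: linearNl. Qed.
Lemma dotmxNr n (u w : 'rV[C]_n) : '[w, - u] = - '[w, u].
Proof. exact: linearNr. Qed.
Lemma dotmxMnl n (u w : 'rV[C]_n) k : '[u *+ k, w] = '[u, w] *+ k.
Proof. exact: linearMnl. Qed.
Lemma dotmxMnr n (u w : 'rV[C]_n) k : '[w, u *+ k] = '[w, u] *+ k.
Proof. exact: linearMnr. Qed.

(** The rules for multiples come first: [x *+ k] is convertible to a sum, which
    the rules for sums would otherwise expand. *)
Definition dotmx_expand := (dotmxMnl, dotmxMnr, dotmxDl, dotmxDr, dotmxNl, dotmxNr).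

Lemma dotmx_ge0 n (u : 'rV[C]_n) : 0 <= '[u].
Proof. exact: dnorm_ge0. Qed.

Lemma dotmx_gt0 n (u : 'rV[C]_n) : (0 < '[u]) = (u != 0).
Proof. exact: dnorm_gt0. Qed.

Lemma mulmxMn m n (u : 'M[C]_(m, n)) (A : 'M_n) k : (u *+ k) *m A = u *m A *+ k.
Proof. exact: (raddfMn (mulmxr A)). Qed.

Lemma posdef_unitmx n (A : 'M[C]_n) :
  (forall x : 'rV_n, x != 0 -> 0 < '[x, x *m A]) -> A \in unitmx.
Proof.
move=> A_gt0; rewrite -row_free_unit; apply: inj_row_free => x xA0.
apply/eqP/negPn/negP => /A_gt0.
by rewrite xA0 [dotmx _ _]linear0r ltxx.
Qed.

(** * Spectrum of the end-corrected polynomial in [T] *)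

Section EndCorrection.
Variables (n : nat) (T F : 'M[C]_n).
Hypothesis T_herm : T ^t* = T.
Hypothesis T_gt0 : forall x : 'rV_n, x != 0 -> 0 < '[x, x *m T].
Hypothesis T_le4 : forall x : 'rV_n, '[x, x *m T] <= '[x] *+ 4.
Hypothesis F_herm : F ^t* = F.
Hypothesis F_idem : F *m F = F.

(** The matrix [13 + T - T F T] acting on rows, in expanded form so that the
    identities below are linear in the words in [T] and [F] applied to [x]. *)
Local Notation K x := (x *+ 13 + x *m T - x *m T *m F *m T).

Lemma dotmx_adjT (u v : 'rV_n) : '[u *m T, v] = '[u, v *m T].
Proof. by rewrite dotmxMl T_herm. Qed.

Lemma dotmx_adjF (u v : 'rV_n) : '[u *m F, v] = '[u, v *m F].
Proof. by rewrite dotmxMl F_herm. Qed.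

Lemma formT_ge0 (x : 'rV_n) : 0 <= '[x, x *m T].
Proof.
have [->|/T_gt0/ltW//] := eqVneq x 0.
by rewrite mul0mx dotmx_ge0.
Qed.

(** [T^2 <= 4 T] follows from [0 <= T <= 4] since
    [4 (4 T - T^2) = T (4 - T) T + (4 - T) T (4 - T)]. *)
Lemma normT_le (x : 'rV_n) : '[x *m T] <= '[x, x *m T] *+ 4.
Proof.
have TST := T_le4 (x *m T); have STS := formT_ge0 (x *+ 4 - x *m T).
rewrite -subr_ge0 in TST.
rewrite -subr_ge0 -(pmulrn_lge0 _ (isT : 0 < 4)%N).
rewrite [leRHS](_ : _ = ('[x *m T] *+ 4 - '[x *m T, x *m T *m T])
   + '[x *+ 4 - x *m T, (x *+ 4 - x *m T) *m T]); first by apply: addr_ge0.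
by rewrite mulmxBl mulmxMn !dotmx_expand !dotmx_adjT; ring.
Qed.

Lemma norm_proj_le (x : 'rV_n) : '[x *m F] <= '[x].
Proof.
rewrite -subr_ge0 (_ : _ - _ = '[x - x *m F]); first exact: dotmx_ge0.
by rewrite !dotmx_expand !dotmx_adjF -!mulmxA F_idem; ring.
Qed.

(** [K - 1 = 3 (4 - T) + (4 T - T^2) + T (1 - F) T], each term being
    nonnegative. *)
Lemma end_corrected_form_ge (x : 'rV_n) : '[x] <= '[x, K x].
Proof.
have h1 := T_le4 x; have h2 := normT_le x; have h3 := norm_proj_le (x *m T).
rewrite -subr_ge0 in h1; rewrite -subr_ge0 in h2; rewrite -subr_ge0 in h3.
rewrite -subr_ge0.
rewrite [leRHS](_ : _ = ('[x] *+ 4 - '[x, x *m T]) *+ 3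
  + ('[x, x *m T] *+ 4 - '[x *m T]) + ('[x *m T] - '[x *m T *m F])).
  by apply: addr_ge0 h3; apply: addr_ge0 h2; apply: mulrn_wge0.
have -> : '[x *m T *m F] = '[x, x *m T *m F *m T].
  by rewrite dotmx_adjF -[_ *m F *m F]mulmxA F_idem dotmx_adjT.
by rewrite !dotmx_expand dotmx_adjT; ring.
Qed.

Lemma shiftT_unitmx : T + 13%:R%:M \in unitmx.
Proof.
apply: posdef_unitmx => x x_neq0.
rewrite mulmxDr mul_mx_scalar scaler_nat !dotmx_expand.
by apply: addr_gt0 (T_gt0 x_neq0) _; rewrite pmulrn_lgt0 // dotmx_gt0.
Qed.

(** This is [13 K^-1 > 1 - T], evaluated at [x K]. *)
Lemma spectral_gap (x : 'rV_n) : x != 0 ->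
  0 < '[x, K x] *+ 13 - '[K x - K x *m T, K x].
Proof.
move=> x_neq0; set y := K x.
have y_neq0 : y != 0.
  have : 0 < '[x, y] by apply: lt_le_trans (end_corrected_form_ge x); rewrite dotmx_gt0.
  by apply: contraTneq => ->; rewrite [dotmx _ _]linear0r ltxx.
(* With w = y A^-1, the inequality K^-1 >= A^-1 at y reads <x, y> >= <w, y>;
   its defect is computed below from d = x - w. *)
have [w def_y] : exists w, y = w *+ 13 + w *m T.
  exists (y *m invmx (T + 13%:R%:M)); rewrite -[LHS](mulmxKV shiftT_unitmx).
  by rewrite mulmxDr mul_mx_scalar scaler_nat addrC.
have w_neq0 : w != 0.
  by apply: contra_neq y_neq0 => w0; rewrite def_y w0 mul0mx mul0rn addr0.
have [d def_x] : exists d, x = d + w by exists (x - w); rewrite subrK.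
(* (x - w) K = w A - w K. *)
have Kd : K d = w *m T *m F *m T.
  have := def_y; rewrite /y def_x !mulmxDl.
  move: (d *m T) (w *m T) => a b; move: (a *m F *m T) (b *m F *m T) => c e.
  move/rowP => H; apply/rowP => k; move: (H k); rewrite !mxE => /eqP.
  rewrite -subr_eq0 => /eqP Hk.
  by apply/eqP; rewrite -subr_eq0 -Hk; apply/eqP; ring.
have dKd_ge0 : 0 <= '[d, w *m T *m F *m T].
  by rewrite -Kd; apply: le_trans (end_corrected_form_ge d); exact: dotmx_ge0.
have dy : '[d, y] = '[d, w *m T *m F *m T] + '[w *m T *m F].
  have -> : '[w *m T *m F] = '[w *m T *m F *m T, w].
    by rewrite dotmx_adjT -dotmx_adjF -[_ *m F *m F]mulmxA F_idem.
  have -> : '[d, w *m T *m F *m T] = '[d *m T *m F *m T, w].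
    by rewrite dotmx_adjT dotmx_adjF dotmx_adjT.
  by rewrite -Kd def_y !dotmx_expand !dotmx_adjT; ring.
rewrite def_x dotmxDl dy def_y mulmxDl mulmxMn.
(* 156 T + 25 T^2 + T^3 = A (13 - A (1 - T)). *)
have -> : ('[d, w *m T *m F *m T] + '[w *m T *m F] + '[w, w *+ 13 + w *m T]) *+ 13
    - '[w *+ 13 + w *m T - (w *m T *+ 13 + w *m T *m T), w *+ 13 + w *m T]
  = ('[d, w *m T *m F *m T] + '[w *m T *m F]) *+ 13
    + '[w, w *m T] *+ 156 + '[w *m T] *+ 25 + '[w *m T, w *m T *m T].
  by rewrite !dotmx_expand !dotmx_adjT; ring.
rewrite ltr_wpDr ?formT_ge0 // ltr_wpDr ?mulrn_wge0 ?dotmx_ge0 // ltr_wpDl //.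
  by rewrite mulrn_wge0 // addr_ge0 // dotmx_ge0.
by rewrite pmulrn_lgt0 // T_gt0.
Qed.

Lemma end_corrected_eigenvalue_gt0 z :
  eigenvalue (T *+ 12 + T *m T + F *m (T *m T) *m (1%:M - T)) z -> 0 < z.
Proof.
case/eigenvalueP => v v_eig v_neq0.
have T_unit := posdef_unitmx T_gt0.
have [x def_v] : exists x, v = x *m T by exists (v *m invmx T); rewrite mulmxKV.
have x_neq0 : x != 0 by apply: contra_neq v_neq0 => x0; rewrite def_v x0 mul0mx.
have xKx_gt0 : 0 < '[x, K x].
  by apply: lt_le_trans (end_corrected_form_ge x); rewrite dotmx_gt0.
(* The conjugated eigenvector equation: x K (1 - T) = (13 - z) x. *)
have Kx_eig : K x - K x *m T = x *+ 13 - z *: x.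
  apply: (can_inj (mulmxK T_unit)).
  have -> : (x *+ 13 - z *: x) *m T = v *+ 13 - z *: v.
    by rewrite mulmxBl mulmxMn -scalemxAl -def_v.
  rewrite -v_eig (mulmxDr v (T *+ 12 + _)) (mulmxDr v (T *+ 12)).
  rewrite [v *m (T *+ 12)](raddfMn (mulmx v)) /= mulmxA.
  rewrite !mulmxA (mulmxBr _ 1%:M) mulmx1 -!def_v.
  rewrite !mulmxBl (mulmxDl (x *+ 13)) !mulmxMn -!def_v mulmxDl mulmxMn.
  move: (v *m T) (v *m F *m T *m T) => a b.
  move: (a *m T) (b *m T) => c e.
  by apply/rowP => k; rewrite !mxE; ring.
have := spectral_gap x_neq0; rewrite Kx_eig dotmxDl dotmxMnl dotmxNl.
have -> : '[z *: x, K x] = z * '[x, K x] by exact: linearZl_LR.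
by rewrite opprB addrC subrK pmulr_lgt0.
Qed.

End EndCorrection.
End Forms.

(** * The stencil in terms of the second-difference matrix *)

Section Entries.
Variable R : comNzRingType.

Lemma sum_delta n a (g : nat -> R) :
  \sum_(k < n) (k == a :> nat)%:R * g k = (a < n)%:R * g a.
Proof.
have [an|na] := ltnP a n; last first.
  rewrite mul0r big1 // => k _; have /ltn_eqF -> : (k < a)%N by apply: leq_trans na.
  by rewrite mul0r.
rewrite (bigD1 (Ordinal an)) //= eqxx big1 ?addr0 // => k /negPf.
by rewrite -val_eqE /= => ->; rewrite mul0r.
Qed.

Definition tridiag (e : R) (i j : nat) : R :=
  (j == i)%:R *+ 2 + e * (j == i.+1)%:R + e * (i == j.+1)%:R.

Definition tridiag_mx n (e : R) : 'M[R]_n := \matrix_(i, j) tridiag e i j.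

(** The columns are indexed by the [n.+1] mesh intervals: for [e = -1] this is,
    up to sign, the first-difference matrix with Dirichlet boundary values. *)
Definition bidiag_mx n (e : R) : 'M[R]_(n, n.+1) :=
  \matrix_(i, k) ((k == i :> nat)%:R + e * (k == i.+1 :> nat)%:R).

Ltac decide_eqs :=
  repeat match goal with |- context [@eq_op _ ?a ?b] =>
    first [ rewrite (_ : (a == b) = true); last by lia
          | rewrite (_ : (a == b) = false); last by lia ]
  end;
  rewrite /=.

Lemma bidiag_gram n (e : R) : e * e = 1 ->
  bidiag_mx n e *m (bidiag_mx n e)^T = tridiag_mx n e.
Proof.
move=> ee; apply/matrixP => i j; rewrite !mxE.
under eq_bigr => k _ do rewrite !mxE mulrDl -mulrA.
rewrite big_split -mulr_sumr /=.
rewrite (sum_delta n.+1 i (fun k => (k == j :> nat)%:R + e * (k == j.+1)%:R)).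
rewrite (sum_delta n.+1 i.+1 (fun k => (k == j :> nat)%:R + e * (k == j.+1)%:R)).
rewrite ltnS (ltnW (ltn_ord i)) ltnS ltn_ord !mul1r /tridiag mulrDr mulrA ee mul1r.
case: i j => [i ilt] [j jlt] /=.
have [->|ij] := eqVneq i j; first by decide_eqs; ring.
have [->|ij2] := eqVneq i j.+1; first by decide_eqs; ring.
by have [->|ij3] := eqVneq j i.+1; decide_eqs; ring.
Qed.

(** Row-wise action of [tridiag_mx] on a matrix whose entries are given by a
    function on natural numbers; the factors [i.+1 < n] and [0 < i] cut off the
    neighbours that lie outside the grid. *)
Definition tridiag_mul n (e : R) (a : nat -> nat -> R) i j : R :=
  a i j *+ 2 + e * ((i.+1 < n)%N%:R * a i.+1 j) + e * ((0 < i)%N%:R * a i.-1 j).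

Lemma tridiag_mxM n p (e : R) (a : nat -> nat -> R) :
  tridiag_mx n e *m (\matrix_(i, j) a i j) =
  \matrix_(i < n, j < p) tridiag_mul n e a i j.
Proof.
apply/matrixP => i j; rewrite !mxE.
transitivity (\sum_(k < n) ((k == i :> nat)%:R * (a k j *+ 2)
  + (k == i.+1 :> nat)%:R * (e * a k j)
  + (k == i.-1 :> nat)%:R * ((0 < i)%N%:R * (e * a k j)))).
  apply: eq_bigr => k _; rewrite !mxE /tridiag.
  rewrite (_ : (i == k.+1 :> nat) = (0 < i)%N && (k == i.-1 :> nat)); last by lia.
  by rewrite -mulnb natrM; ring.
rewrite !big_split /= (sum_delta n i (fun k => a k j *+ 2)).
rewrite (sum_delta n i.+1 (fun k => e * a k j)).
rewrite (sum_delta n i.-1 (fun k => (0 < i)%N%:R * (e * a k j))).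
rewrite ltn_ord (leq_ltn_trans (leq_pred i) (ltn_ord i)) /tridiag_mul !mul1r; ring.
Qed.

Definition ends_mx n : 'M[R]_n :=
  diag_mx (\row_j ((j == 0 :> nat) || (j == n.-1 :> nat))%:R).

(** In an interior row, [12 T + T^2] has the entries 1, -16, 30, -16, 1.  With
    [e] the first basis row, the first row of [12 T + T^2] is (29, -16, 1) and
    [e T^2 (1 - T)] is (-9, 10, -5, 1), which add up to (20, -6, -4, 1).  The
    last row is the mirror image. *)
Lemma stencil_mxE n : (5 <= n)%N ->
  let T := tridiag_mx n (-1) in
  stencil_mx R n = T *+ 12 + T *m T + ends_mx n *m (T *m T) *m (1%:M - T).
Proof.
move=> n5 T.
pose t := tridiag (-1); pose t2 := tridiag_mul n (-1) t; pose t3 := tridiag_mul n (-1) t2.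
have TT : T *m T = \matrix_(i, j) t2 i j by exact: tridiag_mxM.
have TTT : T *m T *m T = \matrix_(i, j) t3 i j by rewrite -mulmxA TT tridiag_mxM.
rewrite -scaler_nat -mulmxA mulmxBr mulmx1 TTT TT mul_diag_mx.
apply/matrixP => i j; rewrite !mxE -/(t i j).
case: i j => [i ilt] [j jlt] /=.
have [->|i0] := eqVneq i 0%N.
  rewrite mul1r /t3 /t2 /t /tridiag_mul /tridiag /=.
  have [-> ->] : (1 < n)%N /\ (2 < n)%N by lia.
  by case: j jlt => [|[|[|[|j]]]] jlt /=; ring.
have [->|i1] := eqVneq i n.-1.
  rewrite mul1r /t3 /t2 /t /tridiag_mul /tridiag.
  case: n n5 {T t t2 t3 TT TTT ilt i0} jlt => [|[|[|[|n]]]] // n5 jlt.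
  rewrite /= !ltnS leqnn ltnn.
  have [->|j0] := eqVneq j n.+3; first by rewrite subnn /=; decide_eqs; ring.
  have [->|j1] := eqVneq j n.+2; first by rewrite subSnn /=; decide_eqs; ring.
  have [->|j2] := eqVneq j n.+1.
    by rewrite (_ : n.+3 - n.+1 = 2)%N /=; [decide_eqs; ring | lia].
  have [->|j3] := eqVneq j n.
    by rewrite (_ : n.+3 - n = 3)%N /=; [decide_eqs; ring | lia].
  have -> : (n.+3 - j = (n.+3 - j - 4).+4)%N by lia.
  by rewrite /=; decide_eqs; ring.
rewrite mul0r addr0 /t2 /t /tridiag_mul /tridiag.
have [-> ->] : (0 < i)%N /\ (i.+1 < n)%N by lia.
case: i i0 i1 {ilt} => // i _ i1 /=.
have [->|j0] := eqVneq j i.+1; first by rewrite subrr /=; decide_eqs; ring.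
have [->|j1] := eqVneq j i.
  by rewrite (_ : absz _ = 1%N) /=; [decide_eqs; ring | lia].
have [->|j2] := eqVneq j i.+2.
  by rewrite (_ : absz _ = 1%N) /=; [decide_eqs; ring | lia].
have [->|j3] := eqVneq j i.+3.
  by rewrite (_ : absz _ = 2%N) /=; [decide_eqs; ring | lia].
have [ij|j4] := eqVneq i j.+1.
  by rewrite ij (_ : absz _ = 2%N) /=; [decide_eqs; ring | lia].
have -> : `|(i.+1%:Z - j%:Z)%R|%N = (`|(i.+1%:Z - j%:Z)%R| - 3).+3%N by lia.
by rewrite /=; decide_eqs; ring.
Qed.

End Entries.

(** * The second-difference matrix is between 0 and 4 *)

Section SecondDifference.
Variables (C : numClosedFieldType) (n : nat).

Lemma bidiag_adj (e : C) : e^* = e ->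
  (bidiag_mx n e) ^t* = (bidiag_mx n e)^T.
Proof.
by move=> eC; apply/matrixP => i j; rewrite !mxE rmorphD rmorphM /= eC !rmorph_nat.
Qed.

Lemma tridiag_form (e : C) (x : 'rV_n) : e^* = e -> e * e = 1 ->
  '[x, x *m tridiag_mx n e] = '[x *m bidiag_mx n e].
Proof.
by move=> eC ee; rewrite dotmxMl bidiag_adj // -mulmxA bidiag_gram.
Qed.

Lemma tridiag_herm (e : C) : e^* = e -> e * e = 1 ->
  (tridiag_mx n e) ^t* = tridiag_mx n e.
Proof.
move=> eC ee; rewrite -(bidiag_gram n ee) -(bidiag_adj eC).
by rewrite trmx_mul map_mxM /= trmxCK.
Qed.

(** The columns of [bidiag_mx n e] determine the coordinates of [x] one after
    the other, as [(x *m bidiag_mx n e)_k = x_k + e x_(k-1)]. *)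
Lemma bidiag_inj (e : C) (x : 'rV_n) : x *m bidiag_mx n e = 0 -> x = 0.
Proof.
move=> xG0; apply/rowP => i; rewrite mxE.
elim/ltn_ind: {i}(i : nat) {-2}i (erefl (i : nat)) => m IH i def_i.
have := congr1 (fun A : 'rV_n.+1 => A 0 (widen_ord (leqnSn n) i)) xG0.
rewrite !mxE (bigD1 i) //= big1 => [|j j_neq_i].
  by rewrite !mxE /= eqxx (ltn_eqF (ltnSn i)) mulr0 !addr0 mulr1.
rewrite !mxE /=; have [ji|ij] := ltnP j i.
  by rewrite (IH j) ?mul0r // -def_i.
have /negPf -> : (i : nat) != j by rewrite eq_sym.
by rewrite (ltn_eqF (ij : (i < j.+1)%N)) mulr0 addr0 mulr0.
Qed.

Lemma tridiag_form_gt0 (x : 'rV[C]_n) : x != 0 ->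
  0 < '[x, x *m tridiag_mx n (-1)].
Proof.
move=> x_neq0; rewrite tridiag_form ?mulrNN ?mulr1 ?rmorphN1 //.
by rewrite dotmx_gt0; apply: contra_neq x_neq0 => /bidiag_inj.
Qed.

(** [4 - tridiag(-1, 2, -1) = tridiag(1, 2, 1)] is again a Gram matrix. *)
Lemma tridiag_form_le4 (x : 'rV[C]_n) :
  '[x, x *m tridiag_mx n (-1)] <= '[x] *+ 4.
Proof.
have -> : tridiag_mx n (-1) = 4%:R%:M - tridiag_mx n (1 : C).
  apply/matrixP => i j; rewrite !mxE /tridiag eq_sym -val_eqE /=.
  by case: (_ == _) => /=; ring.
rewrite mulmxBr mul_mx_scalar scaler_nat dotmxDr dotmxNr dotmxMnr.
by rewrite lerBlDr lerDl tridiag_form ?mulr1 ?rmorph1 ?dotmx_ge0.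
Qed.

Lemma ends_herm : (ends_mx C n) ^t* = ends_mx C n.
Proof.
rewrite tr_diag_mx map_diag_mx; congr diag_mx.
by apply/rowP => j; rewrite !mxE rmorph_nat.
Qed.

Lemma ends_idem : ends_mx C n *m ends_mx C n = ends_mx C n.
Proof.
rewrite mulmx_diag; congr diag_mx.
by apply/rowP => j; rewrite !mxE -natrM mulnb andbb.
Qed.

Lemma stencil_eigenvalue_gt0 (z : C) : (5 <= n)%N ->
  eigenvalue (stencil_mx C n) z -> 0 < z.
Proof.
move=> n5; rewrite stencil_mxE //; apply: end_corrected_eigenvalue_gt0.
- by apply: tridiag_herm; rewrite ?rmorphN1 ?mulrNN ?mulr1.
- exact: tridiag_form_gt0.
- exact: tridiag_form_le4.
- exact: ends_herm.
- exact: ends_idem.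
Qed.

End SecondDifference.

Lemma eigenvalue_scale (K : fieldType) n (A : 'M[K]_n) (c z : K) : c != 0 ->
  eigenvalue (c *: A) z -> eigenvalue A (c^-1 * z).
Proof.
move=> c_neq0 /eigenvalueP[v v_eig v_neq0]; apply/eigenvalueP; exists v => //.
by rewrite -scalerA -v_eig -scalemxAr scalerA mulVf // scale1r.
Qed.

Lemma map_stencil_mx (R S : pzRingType) (f : {rmorphism R -> S}) n :
  map_mx f (stencil_mx R n) = stencil_mx S n.
Proof.
apply/matrixP => i j; rewrite !mxE.
case: eqP => _; last case: eqP => _.
- by case: (j : nat) => [|[|[|[|k]]]] /=; rewrite ?rmorphN ?rmorph_nat ?rmorph1 ?rmorph0.
- by case: (_ - _)%N => [|[|[|[|k]]]] /=; rewrite ?rmorphN ?rmorph_nat ?rmorph1 ?rmorph0.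
- by case: absz => [|[|[|k]]] /=; rewrite ?rmorphN ?rmorph_nat ?rmorph1 ?rmorph0.
Qed.

Theorem theorem2 (R : realType) (n : nat) (hn : (5 <= n)%N) (z : complex R)
    (hz : eigenvalue (map_mx (real_complex R) (discrete_laplacian R n)) z) :
  complex.Im z = 0 /\ 0 < complex.Re z.
Proof.
pose c : R := 1 / (12%:R * mesh_size R n ^+ 2).
have c_gt0 : 0 < real_complex R c.
  rewrite ltcR /c /mesh_size divr_gt0 // mulr_gt0 ?ltr0n //.
  by rewrite exprn_gt0 // divr_gt0 // ltr0n.
move: hz; rewrite /discrete_laplacian -/c map_mxZ map_stencil_mx.
move=> /(eigenvalue_scale (lt0r_neq0 c_gt0)) /(stencil_eigenvalue_gt0 hn).
by rewrite pmulr_rgt0 ?invr_gt0 // ltcE => /andP[/eqP].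
Qed.
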